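(* Let $\mu$ be a cardinal with $\mu>\mathrm{cf}(\mu)=\kappa>\aleph_0$ and let $\lambda=\mu^+$. Assume that for some ordinal $\theta\in(\kappa,\lambda)$, $\theta$ has the weak reflection property for $\kappa$. Then the filter ${\cal D}_\lambda\restriction S^\lambda_\kappa$ is not $\lambda^+$-saturated; that is, there are $\lambda^+$ many stationary subsets of $S^\lambda_\kappa$ such that the intersection of any two distinct of them is non-stationary in $\lambda$.
   Context: For an ordinal $\gamma$ and regular cardinal $\chi$, $S^\gamma_\chi=\{\delta<\gamma:\mathrm{cf}(\delta)=\chi\}$. ${\cal D}_\lambda$ is the club filter on $\lambda$, and ${\cal D}_\lambda\restriction S=\{X\cap S: X\in{\cal D}_\lambda\}$. A filter ${\cal D}$ on a set $A$ is $\sigma$-saturated iff there are no $\sigma$ many ${\cal D}$-positive sets (sets whose complement is not in ${\cal D}$) such that no two of them have ${\cal D}$-positive intersection. For a regular cardinal $\chi>\aleph_0$ and an ordinal $\eta>\chi$: $\eta$ has the strong non-reflection property for $\chi$ if there is a function $h:\eta\to\chi$ such that for every $\delta\in S^\eta_\chi$ there is a club $C$ of $\delta$ with $h\restriction C$ strictly increasing; otherwise $\eta$ has the weak reflection property for $\chi$ (is weakly reflective for $\chi$). *)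

(* Defs.v *)
(* Ordinals are modelled as well-ordered types (T, lt);
   an ordinal delta < eta is an element delta : T, and the ordinal delta
   itself is the initial segment {x : T | lt x delta}. *)
From Stdlib Require Import Classical.

Set Implicit Arguments.

Section Ord.

Definition leo {A : Type} (lt : A -> A -> Prop) (x y : A) : Prop := lt x y \/ x = y.

Definition is_wo {A : Type} (lt : A -> A -> Prop) : Prop :=
  (forall x y z, lt x y -> lt y z -> lt x z) /\
  (forall x, ~ lt x x) /\
  (forall x y, lt x y \/ x = y \/ lt y x) /\
  well_founded lt.

Definition seg {A : Type} (lt : A -> A -> Prop) (d : A) : Type := {x : A | lt x d}.
Definition seg_lt {A : Type} (lt : A -> A -> Prop) (d : A) (x y : seg lt d) : Prop :=
  lt (proj1_sig x) (proj1_sig y).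

Definition strict_incr {A B : Type} (ltA : A -> A -> Prop) (ltB : B -> B -> Prop)
  (f : A -> B) : Prop := forall x y, ltA x y -> ltB (f x) (f y).

Definition ord_le {A B : Type} (ltA : A -> A -> Prop) (ltB : B -> B -> Prop) : Prop :=
  exists f : A -> B, strict_incr ltA ltB f.
Definition ord_lt {A B : Type} (ltA : A -> A -> Prop) (ltB : B -> B -> Prop) : Prop :=
  ord_le ltA ltB /\ ~ ord_le ltB ltA.

Definition injective_fun {A B : Type} (f : A -> B) : Prop := forall x y, f x = f y -> x = y.

Definition is_cardinal {A : Type} (lt : A -> A -> Prop) : Prop :=
  forall a : A, ~ exists f : A -> seg lt a, injective_fun f.

Definition cofinal {A : Type} (lt : A -> A -> Prop) (P : A -> Prop) : Prop :=
  forall a, exists b, P b /\ leo lt a b.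

Definition cf_eq {A B : Type} (ltA : A -> A -> Prop) (ltB : B -> B -> Prop) : Prop :=
  (exists f : B -> A, strict_incr ltB ltA f /\ cofinal ltA (fun a => exists b, f b = a)) /\
  (forall (C : Type) (ltC : C -> C -> Prop), is_wo ltC ->
     forall g : C -> A, cofinal ltA (fun a => exists c, g c = a) -> ord_le ltB ltC).

Definition is_succ_cardinal {M L : Type} (ltM : M -> M -> Prop) (ltL : L -> L -> Prop) : Prop :=
  is_cardinal ltL /\ ord_lt ltM ltL /\
  (forall (C : Type) (ltC : C -> C -> Prop), is_wo ltC -> is_cardinal ltC ->
     ord_lt ltM ltC -> ord_le ltL ltC).

Definition club_below {T : Type} (lt : T -> T -> Prop) (d : T) (C : T -> Prop) : Prop :=
  (forall x, C x -> lt x d) /\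
  (forall x, lt x d -> exists c, C c /\ leo lt x c) /\
  (forall y, lt y d -> (exists x, lt x y) ->
     (forall x, lt x y -> exists c, C c /\ lt x c /\ lt c y) -> C y).

Definition club {T : Type} (lt : T -> T -> Prop) (C : T -> Prop) : Prop :=
  (forall x, exists c, C c /\ leo lt x c) /\
  (forall y, (exists x, lt x y) ->
     (forall x, lt x y -> exists c, C c /\ lt x c /\ lt c y) -> C y).

Definition stationary {T : Type} (lt : T -> T -> Prop) (S : T -> Prop) : Prop :=
  forall C, club lt C -> exists x, S x /\ C x.

Definition S_cf {T K : Type} (lt : T -> T -> Prop) (ltK : K -> K -> Prop) (d : T) : Prop :=
  cf_eq (@seg_lt T lt d) ltK.

Definition strong_nonreflection {T K : Type} (lt : T -> T -> Prop) (ltK : K -> K -> Prop) : Prop :=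
  exists h : T -> K, forall d : T, S_cf lt ltK d ->
    exists C : T -> Prop, club_below lt d C /\
      (forall x y, C x -> C y -> lt x y -> ltK (h x) (h y)).

Definition weakly_reflective {T K : Type} (lt : T -> T -> Prop) (ltK : K -> K -> Prop) : Prop :=
  ~ strong_nonreflection lt ltK.

End Ord.

(* Main.v *)
(* Fix a normal cofinal sequence of type kappa in every delta of cofinality kappa, and write each
   y < lambda as an increasing union of sets B y i (i < kappa), of size bounded below mu uniformly
   in y. Say that f : lambda -> lambda is guessed at delta with index i if, for y ranging over the
   chosen sequence in delta, the graph of f meets the union of the squares of the B y i
   unboundedly below delta. Weak reflection of theta, copied into an arbitrary club by a
   continuous enumeration, yields a delta in the club at which f is guessed.

   Take a maximal, hence more than lambda sized, family of eventually different functions; more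
   than lambda many of them are guessed on a stationary set D f with one index i. If the club
   filter on cofinality kappa were lambda^+-saturated, one could pick mu many disjoint subfamilies
   X e of size at most lambda, each predense below all the remaining D f. For an f outside all
   of them, a typical delta in D f lies in D x_e for some x_e in X e, for all e < mu at once. Since
   the x_e are different beyond a point below delta, mu many different pairs (w, x_e w) lie in
   the union of kappa many squares of size less than mu, a contradiction. *)
Require Import Defs.
From Stdlib Require Import Arith Cantor Lia Wellfounded ssreflect.
From Stdlib Require Import Classical ClassicalEpsilon FunctionalExtensionality PropExtensionality.
From mathcomp Require classical_sets.

Set Implicit Arguments.
Unset Strict Implicit.

(** * Choice, embeddings and well-founded recursion *)

Definition embeds (A B : Type) : Prop := exists f : A -> B, injective_fun f.

Definition least {U : Type} (lt : U -> U -> Prop) (P : U -> Prop) (u : U) : Prop :=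
  P u /\ forall v, P v -> leo lt u v.

Definition choose {U : Type} (d : U) (P : U -> Prop) : U := epsilon (inhabits d) P.

Lemma chooseP {U : Type} (d : U) (P : U -> Prop) : (exists u, P u) -> P (choose d P).
Proof. exact: epsilon_spec. Qed.

Lemma choice_fun {A B : Type} (R : A -> B -> Prop) :
  (forall a, exists b, R a b) -> exists f : A -> B, forall a, R a (f a).
Proof.
move=> H; exists (fun a => proj1_sig (constructive_indefinite_description _ (H a))) => a.
exact: proj2_sig.
Qed.

Lemma embeds_trans (A B C : Type) : embeds A B -> embeds B C -> embeds A C.
Proof. by move=> [f Hf] [g Hg]; exists (fun x => g (f x)) => x y /Hg /Hf. Qed.

Lemma embeds_prod (A B C D : Type) : embeds A C -> embeds B D -> embeds (A * B) (C * D).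
Proof.
move=> [f Hf] [g Hg]; exists (fun p => (f (fst p), g (snd p))) => -[a b] [a' b'] /=.
by case=> /Hf -> /Hg ->.
Qed.

Lemma embeds_sub (A : Type) (P : A -> Prop) : embeds {a | P a} A.
Proof. by exists (@proj1_sig _ _) => x y; apply: eq_sig_hprop => a; exact: proof_irrelevance. Qed.

Lemma sub_val_inj (A : Type) (P : A -> Prop) (x y : {a | P a}) :
  proj1_sig x = proj1_sig y -> x = y.
Proof. by apply: eq_sig_hprop => a; exact: proof_irrelevance. Qed.

Lemma embeds_subset (A : Type) (P Q : A -> Prop) :
  (forall a, P a -> Q a) -> embeds {a | P a} {a | Q a}.
Proof.
move=> H; exists (fun x => exist _ (proj1_sig x) (H _ (proj2_sig x))) => x y [].
exact: sub_val_inj.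
Qed.

Lemma embeds_rel (A B : Type) (R : A -> B -> Prop) :
  (forall a, exists b, R a b) -> (forall a a' b, R a b -> R a' b -> a = a') -> embeds A B.
Proof.
move=> /choice_fun [f Hf] HR; exists f => x y E; apply: (HR _ _ (f x)) => //.
by rewrite E.
Qed.

(** The step is specified by a relation [G], and the history is passed to it as a relation supported
    below [x], so that specifications never mention proofs of [lt y x]. *)
Lemma wf_rec {A B : Type} (lt : A -> A -> Prop) (G : A -> (A -> B -> Prop) -> B -> Prop)
  : well_founded lt ->
  (forall x (R : A -> B -> Prop), exists b, G x R b) ->
  exists f : A -> B, forall x, G x (fun y b => lt y x /\ f y = b) (f x).
Proof.
move=> wf HG.
pose s x R := proj1_sig (constructive_indefinite_description _ (HG x R)).
have sP x R : G x R (s x R) by exact: proj2_sig.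
pose F x (rec : forall y, lt y x -> B) := s x (fun y b => exists h : lt y x, rec y h = b).
exists (Fix wf (fun _ => B) F) => x.
rewrite Fix_eq; last first.
  move=> y f g fg; congr F; apply: functional_extensionality_dep => z.
  by apply: functional_extensionality_dep.
set X := Fix wf (fun _ => B) F.
have -> : (fun y b => lt y x /\ X y = b) = (fun y b => exists h : lt y x, X y = b).
  apply: functional_extensionality => y; apply: functional_extensionality => b.
  apply: propositional_extensionality.
  by split=> [[h e]|[h e]]; [exists h|split].
exact: sP.
Qed.

(** * Well-orders and their comparison *)

Section WellOrder.
Variables (T : Type) (lt : T -> T -> Prop).
Hypothesis wo : is_wo lt.

Lemma wo_trans x y z : lt x y -> lt y z -> lt x z.
Proof. by case: wo => H _; exact: H. Qed.

Lemma wo_irr x : lt x x -> False.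
Proof. by case: wo => _ [H _]; exact: H. Qed.

Lemma wo_total x y : lt x y \/ x = y \/ lt y x.
Proof. by case: wo => _ [_ [H _]]; exact: H. Qed.

Lemma wo_wf : well_founded lt.
Proof. by case: wo => _ [_ [_ H]]. Qed.

Lemma wo_lt_asym x y : lt x y -> lt y x -> False.
Proof. by move=> a b; apply: wo_irr; exact: (wo_trans a b). Qed.

Lemma wo_not_lt x y : ~ lt x y -> leo lt y x.
Proof. by case: (wo_total x y) => [//|[->|]]; [right|left]. Qed.

Lemma wo_le_not_lt x y : leo lt x y -> ~ lt y x.
Proof. by case=> [h h'|-> h]; [exact: wo_lt_asym h h'|exact: (wo_irr h)]. Qed.

Lemma wo_le_lt x y z : leo lt x y -> lt y z -> lt x z.
Proof. by case=> [h h'|->//]; exact: (wo_trans h h'). Qed.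

Lemma wo_lt_le x y z : lt x y -> leo lt y z -> lt x z.
Proof. by move=> h [h'|<-//]; exact: (wo_trans h h'). Qed.

Lemma wo_le_trans x y z : leo lt x y -> leo lt y z -> leo lt x z.
Proof. by move=> [h|->//] h'; left; exact: (wo_lt_le h h'). Qed.

Lemma wo_le_total x y : leo lt x y \/ leo lt y x.
Proof. by case: (wo_total x y) => [|[->|]]; [left; left|left; right|right; left]. Qed.

Lemma wo_le_max x y : exists z, leo lt x z /\ leo lt y z /\ (z = x \/ z = y).
Proof. by case: (wo_le_total x y) => h; [exists y|exists x]; intuition; right. Qed.

Lemma wo_le_anti x y : leo lt x y -> leo lt y x -> x = y.
Proof. by move=> [h|->//] h'; case: (wo_le_not_lt h' h). Qed.

Lemma ex_least (P : T -> Prop) : (exists x, P x) -> exists x, least lt P x.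
Proof.
move=> [x]; elim/(well_founded_ind wo_wf): x => x IH Px.
case: (classic (exists y, lt y x /\ P y)) => [[y [yx Py]]|H]; first exact: (IH y yx Py).
exists x; split=> // v Pv; apply: wo_not_lt => vx; apply: H; by exists v.
Qed.

Lemma strict_incr_ge (f : T -> T) : strict_incr lt lt f -> forall x, leo lt x (f x).
Proof.
move=> Hf x; elim/(well_founded_ind wo_wf): x => x IH.
apply: wo_not_lt => h; exact: (wo_le_not_lt (IH _ h) (Hf _ _ h)).
Qed.

Lemma seg_wo d : is_wo (@seg_lt T lt d).
Proof.
split; [|split; [|split]].
- by move=> x y z; exact: wo_trans.
- by move=> x; exact: wo_irr.
- move=> x y; case: (wo_total (proj1_sig x) (proj1_sig y)) => [h|[/sub_val_inj ->|h]]; auto.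
- by apply: (wf_inverse_image _ _ lt (@proj1_sig _ _)); exact: wo_wf.
Qed.

Lemma seg_embeds x y : leo lt x y -> embeds (seg lt x) (seg lt y).
Proof. by move=> h; apply: embeds_subset => a ha; exact: (wo_lt_le ha h). Qed.

Lemma seg_seg_embeds x (y : seg lt x) : embeds (seg (@seg_lt T lt x) y) (seg lt (proj1_sig y)).
Proof.
exists (fun z => exist (fun a => lt a (proj1_sig y)) (proj1_sig (proj1_sig z)) (proj2_sig z)).
by move=> a b [] /sub_val_inj /sub_val_inj.
Qed.

End WellOrder.

Lemma wo_pullback (A B : Type) (ltB : B -> B -> Prop) (f : A -> B) :
  is_wo ltB -> injective_fun f -> is_wo (fun x y => ltB (f x) (f y)).
Proof.
move=> wo inj; split; [|split; [|split]].
- by move=> x y z; exact: wo_trans.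
- by move=> x; exact: (@wo_irr _ _ wo).
- by move=> x y; case: (wo_total wo (f x) (f y)) => [|[/inj|]]; auto.
- by apply: wf_inverse_image; exact: (wo_wf wo).
Qed.

Lemma strict_incr_inj {A B : Type} (ltA : A -> A -> Prop) (ltB : B -> B -> Prop) (f : A -> B) :
  is_wo ltA -> is_wo ltB -> strict_incr ltA ltB f -> injective_fun f.
Proof.
move=> wA wB Hf x y E; case: (wo_total wA x y) => [/Hf|[//|/Hf]]; rewrite E => h;
  by case: (wo_irr wB h).
Qed.

Lemma strict_incr_reflects {A B : Type} (ltA : A -> A -> Prop) (ltB : B -> B -> Prop) (f : A -> B) :
  is_wo ltA -> is_wo ltB -> strict_incr ltA ltB f -> forall x y, ltB (f x) (f y) -> ltA x y.
Proof.
move=> wA wB Hf x y h; case: (wo_total wA x y) => [//|[E|/Hf h']].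
  by move: h; rewrite E => /(wo_irr wB).
by case: (wo_lt_asym wB h h').
Qed.

Lemma ord_le_embeds {A B : Type} (ltA : A -> A -> Prop) (ltB : B -> B -> Prop) :
  is_wo ltA -> is_wo ltB -> ord_le ltA ltB -> embeds A B.
Proof. by move=> wA wB [f Hf]; exists f; exact: (strict_incr_inj wA wB Hf). Qed.

(** Greedy recursion: each value is the least admissible element of [E], and is arbitrary once the
    earlier values leave no room. *)
Lemma ex_enumeration {A U : Type} (ltA : A -> A -> Prop) (lt : U -> U -> Prop) (E : U -> Prop) :
  is_wo ltA -> is_wo lt -> inhabited U ->
  exists g : A -> U, forall x, (exists u, E u /\ forall y, ltA y x -> lt (g y) u) ->
    least lt (fun u => E u /\ forall y, ltA y x -> lt (g y) u) (g x).
Proof.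
move=> wA wU [u0].
pose above (R : A -> U -> Prop) u := E u /\ forall y v, R y v -> lt v u.
have [x R|g Hg] := @wf_rec A U ltA
  (fun x R b => (exists u, above R u) -> least lt (above R) b) (wo_wf wA).
  case: (classic (exists u, above R u)) => [|n]; last by exists u0.
  by move/(ex_least wU) => [u hu]; exists u.
exists g => x [u [Eu Hu]]; have [|[E1 H1] H2] := Hg x.
  by exists u; split=> // y v [h <-]; exact: Hu.
split; first by split=> // y h; apply: (H1 y).
by move=> v [Ev Hv]; apply: H2; split=> // y _ [h <-]; exact: Hv.
Qed.

(** Enumerate [U] greedily along [A]. If the enumeration never gets stuck, it embeds [A]. If it
    first gets stuck at [x], every [u] equals [g y] for the first [y] with [u] at most [g y], and
    inverting [g] sends [U] below [x]. *)
Lemma wo_trichotomy {A U : Type} (ltA : A -> A -> Prop) (lt : U -> U -> Prop) :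
  is_wo ltA -> is_wo lt ->
  ord_le ltA lt \/ exists x, ord_le lt (@seg_lt A ltA x).
Proof.
move=> wA wU; case: (classic (inhabited A)) => [[a0]|nA]; last first.
  have f (a : A) : U by case: nA.
  by left; exists f => x; case: nA.
case: (classic (inhabited U)) => [iU|nU]; last first.
  by right; exists a0; have f (u : U) : seg ltA a0 by [case: nU]; exists f => x; case: nU.
have [g Hg] := ex_enumeration (fun _ => True) wA wU iU.
case: (classic (forall x, exists u, forall y, ltA y x -> lt (g y) u)) => [H|].
  left; exists g => y x yx; have [|[_ h] _] := Hg x; last exact: h.
  by case: (H x) => u hu; exists u.
move=> /not_all_ex_not /(ex_least wA) [x [nx lx]]; right; exists x.
have Hb y : ltA y x -> least lt (fun u => True /\ forall z, ltA z y -> lt (g z) u) (g y).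
  move=> yx; apply: Hg; apply: NNPP => n; apply: (wo_le_not_lt wA (lx y _) yx) => -[u hu].
  by apply: n; exists u.
have Hu u : exists y : seg ltA x, g (proj1_sig y) = u.
  have : exists y, ltA y x /\ leo lt u (g y).
    apply: NNPP => n; apply: nx; exists u => y yx; apply: NNPP => h; apply: n; exists y.
    by split=> //; exact: wo_not_lt.
  move=> /(ex_least wA) [y [[yx uy] ly]]; exists (exist _ y yx) => /=.
  apply: (wo_le_anti wU _ uy); apply: (proj2 (Hb y yx)); split=> // z zy.
  apply: NNPP => /(wo_not_lt wU) h; apply: (wo_le_not_lt wA (ly z _) zy).
  by split=> //; exact: (wo_trans wA zy yx).
have [f Hf] := choice_fun Hu; exists f => u v uv; rewrite /seg_lt.
case: (wo_total wA (proj1_sig (f u)) (proj1_sig (f v))) => [//|[e|h]].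
  by move: uv; rewrite -(Hf u) -(Hf v) e => /(wo_irr wU).
case: (wo_lt_asym wU uv); rewrite -(Hf u) -(Hf v).
by case: (Hb _ (proj2_sig (f u))) => -[_ H] _; exact: H.
Qed.

Lemma nat_wo : is_wo Peano.lt.
Proof.
split; [|split; [|split]].
- by move=> x y z; exact: Nat.lt_trans.
- exact: Nat.lt_irrefl.
- by move=> x y; lia.
- exact: Wf_nat.lt_wf.
Qed.

(* Hilbert's hotel along a copy of [nat] frees the point [m]. *)
Lemma infinite_cardinal_no_max {N : Type} (lt : N -> N -> Prop) :
  is_wo lt -> embeds nat N -> is_cardinal lt -> forall m, exists y, lt m y.
Proof.
move=> wo Ns card m; apply: NNPP => n.
have {Ns} [s [sinj sNm]] : exists s : nat -> N, injective_fun s /\ forall k, s k <> m.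
  case: Ns => s sinj; case: (classic (exists k, s k = m)) => [[k e]|h].
    exists (fun j => s (j + S k)); split=> [i j /sinj|j]; first lia.
    by rewrite -e => /sinj; lia.
  by exists s; split=> // k e; apply: h; exists k.
have mx x : leo lt x m by apply: wo_not_lt => // h; apply: n; exists x.
have sm k : lt (s k) m by case: (mx (s k)) => // /sNm.
apply: (card m); apply: (embeds_rel (R := fun x (y : seg lt m) =>
  (x = m /\ proj1_sig y = s 0) \/ (exists k, x = s k /\ proj1_sig y = s (S k)) \/
  (x <> m /\ (forall k, x <> s k) /\ proj1_sig y = x))).
  move=> x; case: (classic (x = m)) => [e|xm].
    by exists (exist _ (s 0) (sm 0)); left.
  case: (classic (exists k, x = s k)) => [[k e]|xs].
    by exists (exist _ (s (S k)) (sm _)); right; left; exists k.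
  have h : lt x m by case: (mx x).
  by exists (exist _ x h); right; right; split=> //; split=> // k e; apply: xs; exists k.
move=> x x' y; case=> [[-> ->]|[[k [-> ->]]|[xm [xs ->]]]].
- by case=> [[-> _]//|[[j [_ /sinj]]//|[_ [h e]]]]; case: (h 0).
- case=> [[_ /sinj]//|[[j [-> /sinj [->]]]//|[_ [h e]]]]; by case: (h (S k)).
- case=> [[_ e]|[[j [_ e]]|[_ [_ ->]]//]]; [by case: (xs 0)|by case: (xs (S j))].
Qed.

(** * Squares of infinite well-orders *)

Definition lex {A B : Type} (ltA : A -> A -> Prop) (ltB : B -> B -> Prop) (p q : A * B) : Prop :=
  ltA (fst p) (fst q) \/ (fst p = fst q /\ ltB (snd p) (snd q)).

Lemma lex_wo {A B : Type} (ltA : A -> A -> Prop) (ltB : B -> B -> Prop) :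
  is_wo ltA -> is_wo ltB -> is_wo (lex ltA ltB).
Proof.
move=> wA wB; split; [|split; [|split]].
- move=> [a b] [a' b'] [a2 b2]; rewrite /lex /= => -[h|[-> h]] [h'|[<- h']]; auto.
    by left; exact: (wo_trans wA h h').
  by right; split=> //; exact: (wo_trans wB h h').
- by move=> [a b] [/(wo_irr wA)|[_ /(wo_irr wB)]].
- move=> [a b] [a' b']; rewrite /lex /=.
  case: (wo_total wA a a') => [|[->|]]; auto.
  by case: (wo_total wB b b') => [|[->|]]; auto.
- move=> [a b]; elim/(well_founded_ind (wo_wf wA)): a b => a IHa b.
  elim/(well_founded_ind (wo_wf wB)): b => b IHb; split=> -[a' b'] [/= h|/= [-> h]].
    exact: IHa.
  exact: IHb.
Qed.

Lemma embeds_square_nat : embeds (nat * nat) nat.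
Proof. by exists Cantor.to_nat => p q e; rewrite -(Cantor.cancel_of_to p) e Cantor.cancel_of_to. Qed.

(** If [N] embeds in a segment, or embeds in [nat], the claim reduces to that case. Otherwise order
    the pairs by maximum first: were this order too long, a copy of [N] would fit into the square of
    an infinite proper segment, hence into the segment, although [N] is a cardinal. *)
Lemma embeds_square_step {N : Type} (lt : N -> N -> Prop) :
  is_wo lt -> embeds nat N ->
  (forall x, embeds nat (seg lt x) -> embeds (seg lt x * seg lt x) (seg lt x)) ->
  embeds (N * N) N.
Proof.
move=> wo Ninf IH.
case: (classic (exists x, embeds N (seg lt x))) => [[x Nx]|card'].
  apply: embeds_trans (embeds_prod Nx Nx) _.
  exact: (embeds_trans (IH x (embeds_trans Ninf Nx)) (embeds_sub _)).
have card : is_cardinal lt by move=> x h; apply: card'; exists x.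
case: (classic (exists x0, embeds nat (seg lt x0))) => [[x0 x0inf]|fin]; last first.
  have [/(ord_le_embeds wo nat_wo) h|[x h]] := wo_trichotomy wo nat_wo.
    exact: (embeds_trans (embeds_prod h h) (embeds_trans embeds_square_nat Ninf)).
  by case: fin; exists x; exact: (ord_le_embeds nat_wo (seg_wo wo x) h).
have [mx Hmx] : exists mx : N * N -> N, forall p,
    leo lt (fst p) (mx p) /\ leo lt (snd p) (mx p).
  apply: (choice_fun (R := fun p m => leo lt (fst p) m /\ leo lt (snd p) m)) => p.
  by have [z [? [? _]]] := wo_le_max wo (fst p) (snd p); exists z.
pose code p := (mx p, p).
have wG : is_wo (fun p q => lex lt (lex lt lt) (code p) (code q)).
  by apply: wo_pullback; [do !apply: lex_wo|move=> p q []].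
have [h|[p h]] := wo_trichotomy wG wo; first exact: (ord_le_embeds wG wo h).
(* All pairs before [p] have coordinates below [y]; staying above [x0] makes the segment of [y]
   infinite, as the induction hypothesis demands. *)
have [y [my x0y]] : exists y, lt (mx p) y /\ leo lt x0 y.
  have [y' h'] := infinite_cardinal_no_max wo Ninf card (mx p).
  have [y [h1 [h2 _]]] := wo_le_max wo y' x0.
  by exists y; split=> //; exact: (wo_lt_le wo h' h1).
case: (card y); apply: embeds_trans (IH y (embeds_trans x0inf (seg_embeds wo x0y))).
apply: embeds_trans (ord_le_embeds wo (seg_wo wG p) h) _.
have le_mx q : lex lt (lex lt lt) (code q) (code p) -> lt (fst q) y /\ lt (snd q) y.
  move=> hq; have qm : leo lt (mx q) (mx p) by case: hq => [|[]]; [left|right].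
  have [h1 h2] := Hmx q.
  by split; apply: wo_le_lt my => //; apply: wo_le_trans qm.
exists (fun q => (exist (fun a => lt a y) _ (proj1 (le_mx _ (proj2_sig q))),
          exist (fun a => lt a y) _ (proj2 (le_mx _ (proj2_sig q))))).
move=> q q' [e1 e2]; apply: sub_val_inj.
by case: (proj1_sig q) (proj1_sig q') e1 e2 => a b [a' b'] /= -> ->.
Qed.

Lemma embeds_square {N : Type} (lt : N -> N -> Prop) :
  is_wo lt -> embeds nat N -> embeds (N * N) N.
Proof.
move=> wo Ninf; apply: (embeds_square_step wo Ninf) => x.
elim/(well_founded_ind (wo_wf wo)): x => x IH xinf.
apply: (embeds_square_step (seg_wo wo x) xinf) => y yinf.
have ss := seg_seg_embeds y.
have ss' : embeds (seg lt (proj1_sig y)) (seg (@seg_lt _ lt x) y).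
  pose F (z : seg lt (proj1_sig y)) : seg lt x :=
    exist _ (proj1_sig z) (wo_trans wo (proj2_sig z) (proj2_sig y)).
  exists (fun z => exist (fun a : seg lt x => seg_lt a y) (F z) (proj2_sig z)).
  by move=> z z' [] /sub_val_inj.
apply: embeds_trans (embeds_prod ss ss) (embeds_trans _ ss').
by apply: IH; [exact: (proj2_sig y)|exact: (embeds_trans yinf ss)].
Qed.

(** * Regular orders, clubs and cofinality *)

Definition bounded {A T : Type} (lt : T -> T -> Prop) (g : A -> T) : Prop :=
  exists b, forall a, lt (g a) b.

(** Apart from the empty order, these are the uncountable regular cardinals: the last clause rules
    out countable cofinality. *)
Definition regular {T : Type} (lt : T -> T -> Prop) : Prop :=
  is_wo lt /\ (forall x (g : seg lt x -> T), bounded lt g) /\ (forall g : nat -> T, bounded lt g).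

(** On a regular order the sets of closure points are clubs, and every club contains one of them.
    Clubs are therefore handled through functions [b], and intersections through pointwise
    bounds. *)
Definition closure_pt {T : Type} (lt : T -> T -> Prop) (b : T -> T) (y : T) : Prop :=
  (exists x, lt x y) /\ forall x, lt x y -> lt (b x) y.

Section Regular.
Variables (T : Type) (lt : T -> T -> Prop).
Hypothesis reg : regular lt.

Lemma regular_wo : is_wo lt.
Proof. by case: reg. Qed.
Let wo := regular_wo.

Lemma regular_above2 x y : exists z, lt x z /\ lt y z.
Proof.
case: reg => _ [_ /(_ (fun n => if n is 0 then x else y))] [z hz]; exists z.
by split; [exact: (hz 0)|exact: (hz 1)].
Qed.

Lemma regular_no_max x : exists z, lt x z.
Proof. by case: (regular_above2 x x) => z []; exists z. Qed.

Lemma regular_bound (P : T -> Prop) x (b : T -> T) : (forall y, P y -> leo lt y x) ->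
  exists z, forall y, P y -> lt (b y) z.
Proof.
move=> hP; have [x' xx'] := regular_no_max x.
case: reg => _ [/(_ x' (fun y => b (proj1_sig y))) [z hz] _]; exists z => y /hP yx.
exact: (hz (exist _ y (wo_le_lt wo yx xx'))).
Qed.

Lemma closure_pt_mono (u b : T -> T) y :
  (forall x, leo lt (u x) (b x)) -> closure_pt lt b y -> closure_pt lt u y.
Proof. by move=> ub [h1 h2]; split=> // x /h2; exact: (wo_le_lt wo). Qed.

(** Iterate a function [s] with [s u] above [u] and above all [b y] for [y] up to [u]. The countably
    many iterates are bounded, and their supremum is closed under [b]. *)
Lemma closure_pt_unbounded (b : T -> T) x : exists y, closure_pt lt b y /\ lt x y.
Proof.
have /choice_fun [s Hs] : forall x, exists z, lt x z /\ forall y, leo lt y x -> lt (b y) z.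
  move=> u; have [z1 h1] := @regular_bound (fun y => leo lt y u) u b (fun _ h => h).
  have [z [hz1 hz2]] := regular_above2 u z1; exists z; split=> // y /h1 h.
  exact: (wo_trans wo h).
pose a n := Nat.iter n s x.
have [y [hy ly]] : exists y, least lt (fun y => forall n, lt (a n) y) y.
  by apply: ex_least => //; case: reg => _ [_ /(_ a)].
exists y; split; last exact: (hy 0).
split=> [|z zy]; first by exists x; exact: (hy 0).
have [n zn] : exists n, leo lt z (a n).
  apply: NNPP => h; apply: (wo_le_not_lt wo (ly z _) zy) => n.
  by apply: NNPP => /(wo_not_lt wo) h'; apply: h; exists n.
exact: (wo_trans wo (proj2 (Hs (a n)) _ zn) (hy (S n))).
Qed.

Lemma closure_pt_limit (b : T -> T) y : closure_pt lt b y ->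
  (forall x, lt x (b x)) -> forall x, lt x y -> exists x', lt x x' /\ lt x' y.
Proof. by move=> [_ h] hb x xy; exists (b x); split=> //; exact: h. Qed.

Lemma closure_pt_closed (b : T -> T) y : (exists x, lt x y) ->
  (forall x, lt x y -> exists c, closure_pt lt b c /\ lt x c /\ lt c y) -> closure_pt lt b y.
Proof.
move=> h1 h2; split=> // x /h2 [c [[_ hc] [/hc xc cy]]]; exact: (wo_trans wo xc cy).
Qed.

Lemma closure_pt_club (b : T -> T) : club lt (closure_pt lt b).
Proof.
split=> [x|]; last exact: closure_pt_closed.
by case: (closure_pt_unbounded b x) => y [h1 h2]; exists y; split=> //; left.
Qed.

(** Let [b x] lie beyond some element of [C] above [x]; then a closure point of [b] is a limit of
    [C]. *)
Lemma club_closure_pt (C : T -> Prop) :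
  club lt C -> exists b, forall y, closure_pt lt b y -> C y.
Proof.
move=> [unb clo].
have /choice_fun [b Hb] : forall x, exists z, exists c, C c /\ lt x c /\ lt c z.
  move=> x; have [x' xx'] := regular_no_max x; have [c [Cc x'c]] := unb x'.
  have [z cz] := regular_no_max c; exists z, c; do !split=> //; exact: (wo_lt_le wo xx' x'c).
exists b => y [h1 h2]; apply: clo => // x xy; have [c [Cc [xc cb]]] := Hb x.
by exists c; do !split=> //; exact: (wo_trans wo cb (h2 _ xy)).
Qed.

Lemma stationary_closure_pt (Z : T -> Prop) :
  stationary lt Z <-> forall b, exists y, Z y /\ closure_pt lt b y.
Proof.
split=> [st b|H C /club_closure_pt [b Hb]]; first exact: (st _ (closure_pt_club b)).
by case: (H b) => y [Zy /Hb Cy]; exists y.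
Qed.

Lemma stationary_subset (Z Z' : T -> Prop) :
  (forall x, Z x -> Z' x) -> stationary lt Z -> stationary lt Z'.
Proof. by move=> h st C /st [x [/h Zx Cx]]; exists x. Qed.

Lemma nonstationary_closure_pt (Z : T -> Prop) :
  ~ stationary lt Z -> exists b, forall y, closure_pt lt b y -> ~ Z y.
Proof.
move=> n; apply: NNPP => h; apply/n/stationary_closure_pt => b.
apply: NNPP => h'; apply: h; exists b => y cy Zy; apply: h'; by exists y.
Qed.

Lemma common_closure_pt {A : Type} (b : A -> T -> T) :
  (forall g : A -> T, bounded lt g) ->
  exists b', forall a y, closure_pt lt b' y -> closure_pt lt (b a) y.
Proof.
move=> bd; have /choice_fun [b' Hb'] : forall x, bounded lt (fun a => b a x) by move=> x; exact: bd.
by exists b' => a y; apply: closure_pt_mono => x; left.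
Qed.

Lemma stationary_cover {A : Type} (Z : A -> T -> Prop) :
  (forall g : A -> T, bounded lt g) ->
  stationary lt (fun y => exists a, Z a y) -> exists a, stationary lt (Z a).
Proof.
move=> bd st; apply: NNPP => h.
have /choice_fun [b Hb] : forall a, exists b, forall y, closure_pt lt b y -> ~ Z a y.
  by move=> a; apply: nonstationary_closure_pt => h'; apply: h; exists a.
have [b' Hb'] := common_closure_pt b bd.
have [y [[a Zy] cy]] := proj1 (stationary_closure_pt _) st b'.
exact: (Hb a y (Hb' a y cy)).
Qed.

End Regular.

Definition cofinal_seq {T K : Type} (lt : T -> T -> Prop) (ltK : K -> K -> Prop) (d : T)
  (c : K -> T) : Prop :=
  strict_incr ltK lt c /\ (forall k, lt (c k) d) /\ forall x, lt x d -> exists k, lt x (c k).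

(** This also holds of the least element, so a normal sequence starts at the minimum of [T]. *)
Definition limit_pt {T : Type} (lt : T -> T -> Prop) (y : T) : Prop :=
  forall x, lt x y -> exists x', lt x x' /\ lt x' y.

(** Besides cofinality, the clauses express continuity at limit indices and closedness of the range
    in [d]. *)
Definition normal_seq {T K : Type} (lt : T -> T -> Prop) (ltK : K -> K -> Prop) (d : T)
  (c : K -> T) : Prop :=
  cofinal_seq lt ltK d c /\
  (forall k, limit_pt ltK k -> forall x, lt x (c k) -> exists j, ltK j k /\ lt x (c j)) /\
  (forall y, lt y d -> (forall x, lt x y -> exists j, lt x (c j) /\ lt (c j) y) ->
     exists k, c k = y).

Section Cofinality.
Variables (T K : Type) (lt : T -> T -> Prop) (ltK : K -> K -> Prop).
Hypotheses (wo : is_wo lt) (reg : regular ltK).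

(** Take [c' k] to be the least strict upper bound of the [c j] with [j] below [k]. It interleaves
    with [c], and a limit [y] of its range is [c' k] for the first [k] with [y] at most [c k]. *)
Lemma ex_normal_seq d c : cofinal_seq lt ltK d c -> exists c', normal_seq lt ltK d c'.
Proof.
move=> [inc [bel cof]]; have woK := regular_wo reg.
have /choice_fun [c' Hc'] : forall k, exists y, least lt (fun y => forall j, ltK j k -> lt (c j) y) y.
  by move=> k; apply: ex_least => //; exists (c k) => j; exact: inc.
have c'c k : leo lt (c' k) (c k) by apply: (proj2 (Hc' k)) => j; exact: inc.
have cc' j k : ltK j k -> lt (c j) (c' k) by case: (Hc' k) => h _; exact: h.
have below k x : lt x (c' k) -> exists j, ltK j k /\ leo lt x (c j).
  move=> xc; apply: NNPP => n; apply: (wo_le_not_lt wo (proj2 (Hc' k) x _) xc) => j jk.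
  by apply: NNPP => /(wo_not_lt wo) h; apply: n; exists j.
have inc' : strict_incr ltK lt c' by move=> j k /cc'; exact: (wo_le_lt wo).
exists c'; split; [split; [|split]|split] => //.
- by move=> k; exact: (wo_le_lt wo (c'c k)).
- move=> x /cof [k xk]; have [k' kk'] := regular_no_max reg k.
  by exists k'; exact: (wo_trans wo xk (cc' _ _ kk')).
- move=> k lim x /below [j [/lim [j' [jj' j'k]] xj]]; exists j'; split=> //.
  exact: (wo_le_lt wo xj (cc' _ _ jj')).
- move=> y yd lim.
  have [k [yk lk]] : exists k, least ltK (fun k => leo lt y (c k)) k.
    by apply: ex_least => //; case: (cof _ yd) => k h; exists k; left.
  exists k; have c'y : leo lt (c' k) y.
    apply: (proj2 (Hc' k)) => j jk; apply: NNPP => /(wo_not_lt wo) h.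
    exact: (wo_le_not_lt woK (lk j h) jk).
  case: c'y => // /lim [j [/(strict_incr_reflects woK wo inc') kj jy]].
  case: (wo_le_not_lt wo yk); exact: (wo_trans wo (cc' _ _ kj) jy).
Qed.

Lemma S_cf_cofinal_seq d : S_cf lt ltK d <-> exists c, cofinal_seq lt ltK d c.
Proof.
have woK := regular_wo reg; split.
  move=> [[f [inc cof]] _]; exists (fun k => proj1_sig (f k)); split; [|split].
  - by move=> j k /inc.
  - by move=> k; exact: (proj2_sig (f k)).
  - move=> x xd; have [y [[k <-] xk]] := cof (exist _ x xd).
    have [k' /inc kk'] := regular_no_max reg k; exists k'.
    by apply: (wo_le_lt wo _ kk'); case: xk => [h|<-]; [left|right].
move=> [c [inc [bel cof]]]; split.
  exists (fun k => exist (fun x => lt x d) (c k) (bel k)); split=> [j k|]; first exact: inc.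
  move=> [x xd]; case: (cof x xd) => k xk.
  by exists (exist _ (c k) (bel k)); split; [exists k|left].
move=> C ltC woC g gcof.
have [|[k [f Hf]]] := wo_trichotomy woK woC; first by [].
have /choice_fun [u Hu] : forall z, exists k, lt (proj1_sig (g z)) (c k).
  by move=> z; apply: cof; exact: (proj2_sig (g z)).
(* A shorter cofinal map has its indices [u z] carried by [f] to positions below [k]; positions
   outside the range of [f] get the default value [j]. Regularity then bounds all [u z] by one
   [b]. *)
have [b Hb] := @regular_bound _ _ reg (fun j => ltK j k)
  k (fun j => choose j (fun i => exists z, proj1_sig (f z) = j /\ u z = i)) (fun _ h => or_introl h).
have [y [[z <-] bz]] := gcof (exist _ (c b) (bel b)).
have zb : ltK (u z) b.
  have := Hb _ (proj2_sig (f z)).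
  have := @chooseP _ (proj1_sig (f z)) (fun i => exists z', proj1_sig (f z') = proj1_sig (f z) /\ u z' = i).
  case; first by exists (u z), z.
  by move=> z' [/sub_val_inj /(strict_incr_inj woC (seg_wo woK k) Hf) -> ->].
case: (wo_lt_asym wo (inc _ _ zb)); apply: (wo_le_lt wo _ (Hu z)).
by case: bz => [h|<-]; [left|right].
Qed.

End Cofinality.

(** An unbounded map into [K] from a shorter well-order would, composed with the cofinal sequence
    [f], contradict the minimality of the cofinality. *)
Lemma regular_cofinality {M K : Type} (ltM : M -> M -> Prop) (ltK : K -> K -> Prop) :
  is_wo ltM -> is_wo ltK -> cf_eq ltM ltK -> ord_lt Peano.lt ltK -> regular ltK.
Proof.
move=> wM wK [[f [inc cof]] min] [_ nK].
have key (C : Type) (ltC : C -> C -> Prop) (g : C -> K) :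
    is_wo ltC -> ~ ord_le ltK ltC -> bounded ltK g.
  move=> wC nC; apply: NNPP => nb; apply: nC; apply: (min C ltC wC (fun z => f (g z))) => m.
  have [_ [[k <-] mk]] := cof m.
  have [z kz] : exists z, leo ltK k (g z).
    apply: NNPP => h; apply: nb; exists k => z; apply: NNPP => /(wo_not_lt wK) h'; apply: h.
    by exists z.
  exists (f (g z)); split; first by exists z.
  by apply: (wo_le_trans wM mk); case: kz => [/inc h|->]; [left|right].
split=> //; split=> [x g|g]; last exact: (key _ _ _ nat_wo nK).
apply: (key _ _ _ (seg_wo wK x)) => -[h Hh].
have inc' : strict_incr ltK ltK (fun k => proj1_sig (h k)) by move=> j k /Hh.
exact: (wo_le_not_lt wK (strict_incr_ge wK inc' x) (proj2_sig (h x))).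
Qed.

(** * Guessing by weak reflection *)

(** Restates weak reflection of the segment [theta] for points of [T] itself, removing segments of
    segments. *)
Lemma weakly_reflective_seg {T K : Type} (lt : T -> T -> Prop) (ltK : K -> K -> Prop) theta :
  is_wo lt -> regular ltK -> weakly_reflective (@seg_lt T lt theta) ltK ->
  forall h : T -> K, exists d, (exists c, cofinal_seq lt ltK d c) /\
    forall C, club_below lt d C -> exists x y, C x /\ C y /\ lt x y /\ ~ ltK (h x) (h y).
Proof.
move=> wo reg refl h; apply: NNPP => n; apply: refl.
exists (fun x => h (proj1_sig x)) => d.
move=> /(S_cf_cofinal_seq (seg_wo wo theta) reg) [c [inc [bel cof]]].
pose dv := proj1_sig d.
have cv : cofinal_seq lt ltK dv (fun k => proj1_sig (c k)).
  split; [exact: inc|split; first exact: bel].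
  move=> x xd; have xt := wo_trans wo xd (proj2_sig d).
  by case: (cof (exist _ x xt) xd) => k; exists k.
have [C [[Cb [Cu Cc]] Ch]] : exists C, club_below lt dv C /\
    forall x y, C x -> C y -> lt x y -> ltK (h x) (h y).
  apply: NNPP => n'; apply: n; exists dv; split; first by exists (fun k => proj1_sig (c k)).
  move=> C Cclub; apply: NNPP => n2; apply: n'; exists C; split=> // x y Cx Cy xy.
  by apply: NNPP => hxy; apply: n2; exists x, y.
exists (fun x => C (proj1_sig x)); split; last by move=> x y; exact: Ch.
split; [|split].
- by move=> x /Cb.
- move=> x /Cu [y [Cy xy]]; exists (exist _ y (wo_trans wo (Cb _ Cy) (proj2_sig d))).
  by split=> //; case: xy => e; [left|right; exact: sub_val_inj].
- move=> y yd [x xy] lim; apply: Cc => //; first by exists (proj1_sig x).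
  move=> z zy; case: (lim (exist _ z (wo_trans wo zy (proj2_sig y))) zy) => u hu.
  by exists (proj1_sig u).
Qed.

Definition filtration {T K : Type} (lt : T -> T -> Prop) (ltK : K -> K -> Prop)
  (B : T -> K -> T -> Prop) : Prop :=
  (forall y i w, B y i w -> lt w y) /\
  (forall y i j w, leo ltK i j -> B y i w -> B y j w) /\
  (forall y w, lt w y -> exists i, B y i w).

(* The graph of [f] meets the square of the [i]-th approximation to [d] unboundedly often; the
   approximation is the union of the [B y i] for [y] in the range of [c d]. *)
Definition guessed {T K : Type} (lt : T -> T -> Prop) (ltK : K -> K -> Prop)
  (B : T -> K -> T -> Prop) (c : T -> K -> T) (f : T -> T) (i : K) (d : T) : Prop :=
  S_cf lt ltK d /\
  forall x, lt x d -> exists k w, lt x w /\ B (c d k) i w /\ B (c d k) i (f w).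

Section Guessing.
Variables (T K : Type) (lt : T -> T -> Prop) (ltK : K -> K -> Prop).
Hypotheses (regT : regular lt) (regK : regular ltK).
Variables (B : T -> K -> T -> Prop) (c : T -> K -> T).
Hypotheses (Bfil : filtration lt ltK B)
  (cP : forall d, S_cf lt ltK d -> normal_seq lt ltK d (c d)).
Let woT := regular_wo regT.
Let woK := regular_wo regK.

Definition square_unbounded (f : T -> T) (y : T) (i : K) : Prop :=
  forall x, lt x y -> exists w, lt x w /\ B y i w /\ B y i (f w).

(* A limit point [y = c d k] has cofinality below [ltK], so one index [i] serves a whole
   cofinal sequence of witnesses. *)
Lemma ex_square_unbounded d f k : S_cf lt ltK d -> closure_pt lt f (c d k) -> limit_pt ltK k ->
  exists i, square_unbounded f (c d k) i.
Proof.
move=> Sd [ne clo] lim; have [[inc [bel cof]] [cont _]] := cP Sd.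
have Hi (j : seg ltK k) : exists i, B (c d k) i (c d (proj1_sig j)) /\ B (c d k) i (f (c d (proj1_sig j))).
  have jk : lt (c d (proj1_sig j)) (c d k) by apply: inc; exact: (proj2_sig j).
  have [_ [mono tot]] := Bfil; have [i1 h1] := tot _ _ jk; have [i2 h2] := tot _ _ (clo _ jk).
  have [i [l1 [l2 _]]] := wo_le_max woK i1 i2.
  by exists i; split; [exact: mono l1 h1|exact: mono l2 h2].
have [g Hg] := choice_fun Hi; case: regK => _ [/(_ k g) [i hi] _]; exists i => x xy.
have [j [jk xj]] := cont _ lim _ xy; exists (c d j).
have [_ [mono _]] := Bfil; have [h1 h2] := Hg (exist _ j jk).
by split=> //; split; [apply: mono h1|apply: mono h2]; left; exact: hi.
Qed.

(** Let [g] enumerate the closure points continuously and let [h] pick the index of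
    [ex_square_unbounded]. Weak reflection for the composite of [h] and [g] yields a point [d], and
    [g d] is the point sought. *)
Lemma guess_at_closure_pt theta (f b : T -> T) : inhabited K ->
  weakly_reflective (@seg_lt T lt theta) ltK ->
  exists d, closure_pt lt b d /\ exists i, guessed lt ltK B c f i d.
Proof.
move=> [k0] refl.
(* Dominating [b], [f] and the identity at once makes closure points of [b'] limits that are closed
   under [b] and [f]. *)
have /choice_fun [b' Hb'] : forall x, exists z, lt (b x) z /\ lt (f x) z /\ lt x z.
  move=> x; have [z1 [h1 h2]] := regular_above2 regT (b x) (f x).
  have [z [h3 h4]] := regular_above2 regT z1 x; exists z.
  by do !split=> //; apply: (wo_trans woT _ h3).
pose E := closure_pt lt b'.
have Elim y : E y -> limit_pt lt y.
  by move=> Ey; apply: (closure_pt_limit Ey) => x; case: (Hb' x) => _ [_].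
have Ef y : E y -> closure_pt lt f y.
  by apply: closure_pt_mono => // x; left; case: (Hb' x) => _ [].
have Eb y : E y -> closure_pt lt b y.
  by apply: closure_pt_mono => // x; left; case: (Hb' x).
have [g Hg] : exists g : T -> T, forall x, least lt (fun u => E u /\ forall y, lt y x -> lt (g y) u) (g x).
  have [g Hg] := ex_enumeration E woT woT (inhabits theta).
  exists g => x; apply: Hg; case: regT => _ [/(_ x (fun y => g (proj1_sig y))) [z hz] _].
  have [u [Eu zu]] := closure_pt_unbounded regT b' z; exists u; split=> // y yx.
  exact: (wo_trans woT (hz (exist _ y yx)) zu).
have Eg x : E (g x) by case: (Hg x) => -[].
have ginc : strict_incr lt lt g by move=> y x; case: (Hg x) => -[_ h] _; exact: h.
have gleast x u : E u -> (forall y, lt y x -> lt (g y) u) -> leo lt (g x) u.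
  by move=> Eu hu; case: (Hg x) => _; apply.
(* Continuity: the supremum [v] of the earlier values is in [E] because [E] is closed, so [g x]
   cannot exceed it. *)
have gcont x : limit_pt lt x -> (exists y, lt y x) ->
    forall u, lt u (g x) -> exists y, lt y x /\ lt u (g y).
  move=> lim [y0 y0x] u ugx; apply: NNPP => n.
  have [v [hv lv]] : exists v, least lt (fun v => forall y, lt y x -> leo lt (g y) v) v.
    apply: ex_least => //; exists u => y yx; apply: (wo_not_lt woT) => h; apply: n; by exists y.
  have vgx : lt v (g x).
    apply: (wo_le_lt woT _ ugx); apply: lv => y yx; apply: (wo_not_lt woT) => h.
    by apply: n; exists y.
  have hv' y : lt y x -> lt (g y) v.
    by move=> /lim [y' [/ginc h /hv h']]; exact: (wo_lt_le woT h h').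
  apply: (wo_le_not_lt woT _ vgx); apply: gleast => //.
  apply: (closure_pt_closed regT) => [|z zv]; first by exists (g y0); exact: hv'.
  have [y [yx zy]] : exists y, lt y x /\ lt z (g y).
    apply: NNPP => n'; apply: (wo_le_not_lt woT (lv z _) zv) => y yx.
    by apply: (wo_not_lt woT) => h; apply: n'; exists y.
  by exists (g y); split; [exact: Eg|split; [|exact: hv']].
pose h y := choose k0 (square_unbounded f y).
have [d [[cd [dinc [dbel dcof]]] hd]] := weakly_reflective_seg woT regK refl (fun x => h (g x)).
have dlim : limit_pt lt d.
  by move=> x /dcof [k xk]; exists (cd k).
have dne : exists y, lt y d by exists (cd k0).
have Sd : S_cf lt ltK (g d).
  apply/(S_cf_cofinal_seq woT regK); exists (fun k => g (cd k)); split; [|split].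
  - by move=> j k /dinc /ginc.
  - by move=> k; apply: ginc.
  - move=> x /(gcont _ dlim dne) [y [/dcof [k yk] xy]]; exists k.
    exact: (wo_trans woT xy (ginc _ _ yk)).
have [[cinc [cbel ccof]] [ccont cclo]] := cP Sd.
exists (g d); split; first exact: Eb.
apply: NNPP => ng.
pose Z k := limit_pt ltK k /\ exists y, lt y d /\ g y = c (g d) k.
have hsq k : Z k -> square_unbounded f (c (g d) k) (h (c (g d) k)).
  move=> [lim [y [_ e]]]; apply: chooseP; apply: ex_square_unbounded => //.
  by rewrite -e; exact: Ef.
(* Otherwise [h] tends to infinity along the points common to [g] and [c], hence increases on a
   club of [d]. *)
have /choice_fun [bd Hbd] : forall i, exists b, forall k, Z k -> ltK b k -> ltK i (h (c (g d) k)).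
  move=> i; apply: NNPP => n; apply: ng; exists i; split=> // x /ccof [k1 xk1].
  have [k [Zk [k1k hki]]] : exists k, Z k /\ ltK k1 k /\ leo ltK (h (c (g d) k)) i.
    apply: NNPP => n'; apply: n; exists k1 => k Zk k1k; apply: NNPP => /(wo_not_lt woK) h'.
    by apply: n'; exists k.
  have [w [xw [B1 B2]]] := hsq k Zk x (wo_trans woT xk1 (cinc _ _ k1k)).
  have [_ [mono _]] := Bfil.
  by exists k, w; split=> //; split; [exact: mono hki B1|exact: mono hki B2].
(* Between [c (g d) k] and [c (g d) (s k)] lies a value of [g], so at closure points of [s] the two
   sequences meet. *)
have /choice_fun [s Hs] : forall k, exists k', ltK k k' /\ exists y, lt y d /\ lt (c (g d) k) (g y) /\
    lt (g y) (c (g d) k').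
  move=> k; have [y [yd ky]] := gcont d dlim dne _ (cbel k).
  have [k1 yk1] := ccof _ (ginc _ _ yd); have [k' [h1 h2]] := regular_above2 regK k k1.
  by exists k'; split=> //; exists y; do !split=> //; exact: (wo_trans woT yk1 (cinc _ _ h2)).
(* If [j] is below a closure point [k] of [t], then [k] also exceeds the bound [bd] for the index at
   [j], so the index at [k] is larger. *)
have /choice_fun [t Ht] : forall k, exists k', ltK (bd (h (c (g d) k))) k' /\ ltK (s k) k'.
  by move=> k; exact: regular_above2.
have tlim k : closure_pt ltK t k -> limit_pt ltK k.
  move=> ck; apply: (closure_pt_limit ck) => j.
  by case: (Ht j) => _; apply: (wo_trans woK); case: (Hs j).
pose C y := lt y d /\ exists k, closure_pt ltK t k /\ g y = c (g d) k.
have [|x [y [[xd [j [cj ej]]] [[yd [k [ck ek]]] [/ginc]]]]] := hd C; last first.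
  rewrite ej ek => /(strict_incr_reflects woK woT cinc) jk; apply.
  apply: (Hbd _ k); first by split; [exact: tlim|exists y].
  by apply: (wo_trans woK (proj1 (Ht j))); case: ck => _; apply.
split; [by move=> y []|split].
- move=> y yd; have [k0' yk0] := ccof _ (ginc _ _ yd).
  have [k [ck k0k]] := closure_pt_unbounded regK t k0'.
  have [y' [[y'd ky'] ly']] : exists y', least lt (fun y' => lt y' d /\ leo lt (c (g d) k) (g y')) y'.
    apply: ex_least => //; case: (gcont d dlim dne _ (cbel k)) => z [zd kz].
    by exists z; split=> //; left.
  have ey' : g y' = c (g d) k.
    (* As a limit of values of [g], the point [c (g d) k] is in [E]; it exceeds all [g z] with [z]
       below [y'], so [g] cannot skip it at [y']. *)
    apply: (wo_le_anti woT) => //; apply: gleast.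
      apply: (closure_pt_closed regT) => [|x /(ccont _ (tlim _ ck)) [j [jk xj]]].
        by exists (c (g d) k0'); exact: cinc.
      have [_ [z [zd [jz zs]]]] := Hs j; exists (g z); split; [exact: Eg|split].
        exact: (wo_trans woT xj jz).
      apply: (wo_trans woT zs); apply: cinc; apply: (wo_trans woK (proj2 (Ht j))).
      by case: ck => _; apply.
    move=> z zy'; apply: NNPP => /(wo_not_lt woT) h'; apply: (wo_le_not_lt woT (ly' z _) zy').
    by split=> //; exact: (wo_trans woT zy' y'd).
  exists y'; split; first by split=> //; exists k.
  left; apply: (strict_incr_reflects woT woT ginc); rewrite ey'.
  exact: (wo_trans woT yk0 (cinc _ _ k0k)).
- move=> y yd yne ylim.
  have ylim' : limit_pt lt y by move=> x /ylim [z [_]]; exists z.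
  have sup x : lt x (g y) -> exists j, closure_pt ltK t j /\ lt x (c (g d) j) /\ lt (c (g d) j) (g y).
    move=> /(gcont _ ylim' yne) [z [/ylim [z' [[_ [j [cj ej]]] [zz' z'y]]] xz]].
    exists j; rewrite -ej; split=> //; split; last exact: ginc.
    exact: (wo_trans woT xz (ginc _ _ zz')).
  have [k ek] : exists k, c (g d) k = g y.
    by apply: cclo => [|x /sup [j [_ hj]]]; [exact: ginc|exists j].
  split=> //; exists k; split=> //; apply: (closure_pt_closed regK).
    case: yne => z /ginc /sup [j [_ [_]]]; rewrite -ek.
    by move=> /(strict_incr_reflects woK woT cinc); exists j.
  move=> j /cinc; rewrite ek => /sup [j' [cj' [jj']]]; rewrite -ek => j'k; exists j'.
  by split=> //; split; apply: (strict_incr_reflects woK woT cinc).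
Qed.

End Guessing.

(** * Successor cardinals and saturation *)

Lemma ex_maximal_clique {U : Type} (P : U -> Prop) (R : U -> U -> Prop) :
  (forall x y, R x y -> R y x) ->
  exists Z : U -> Prop, (forall x, Z x -> P x) /\ (forall x y, Z x -> Z y -> x <> y -> R x y) /\
    forall z, P z -> (forall x, Z x -> x <> z -> R x z) -> Z z.
Proof.
move=> sym.
pose clique (Z : U -> Prop) := (forall x, Z x -> P x) /\ forall x y, Z x -> Z y -> x <> y -> R x y.
have [F FP tot|Z [[ZP ZR] max]] := @classical_sets.Zorn_bigcup U clique.
  split=> [x [X FX Xx]|x y [X FX Xx] [Y FY Yy] xy]; first exact: (proj1 (FP X FX) x Xx).
  by case: (tot X Y FX FY) => h; [apply: (proj2 (FP Y FY))|apply: (proj2 (FP X FX))] => //; apply: h.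
exists Z; split=> //; split=> // z Pz zR; apply: NNPP => nZ; apply: (max (fun x => Z x \/ x = z)).
  by split=> [x|h]; [left|apply/nZ/h; right].
split=> [x [/ZP|->]//|x y [Zx|->] [Zy|->] xy].
- exact: ZR.
- exact: zR.
- by apply/sym/zR => // e; apply: xy.
- by case: xy.
Qed.

(** The cardinality bound uses a function on all of [U], which spares membership proofs in
    codings. *)
Definition small {U : Type} (L : Type) (P : U -> Prop) : Prop :=
  exists e : U -> L, forall u v, P u -> P v -> e u = e v -> u = v.

Lemma embeds_small {U L : Type} (P : U -> Prop) : inhabited L -> embeds {u | P u} L -> small L P.
Proof.
move=> [l0] [e inj]; pose R u l := exists h : P u, e (exist _ u h) = l.
exists (fun u => choose l0 (R u)) => u v Pu Pv E.
have [h1 e1] : R u (choose l0 (R u)) by apply: chooseP; exists (e (exist _ u Pu)), Pu.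
have [h2 e2] : R v (choose l0 (R v)) by apply: chooseP; exists (e (exist _ v Pv)), Pv.
by move: e1; rewrite E -e2 => /inj [].
Qed.

Section SuccessorCardinal.
Variables (M L : Type) (ltM : M -> M -> Prop) (ltL : L -> L -> Prop).
Hypotheses (woM : is_wo ltM) (woL : is_wo ltL) (infM : embeds nat M)
  (succ : is_succ_cardinal ltM ltL).

(** The segment of a least counterexample would be a cardinal above [M], hence at least as long as
    [L], of which it is a proper segment. *)
Lemma succ_seg_embeds x : embeds (seg ltL x) M.
Proof.
apply: NNPP => n.
have {n x} [x [nx lx]] : exists x, least ltL (fun x => ~ embeds (seg ltL x) M) x.
  by apply: ex_least => //; exists x.
have wx := seg_wo woL x; have [_ [_ min]] := succ.
have [||f Hf] := min _ (@seg_lt L ltL x) wx.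
- move=> a h; apply: nx; apply: embeds_trans h (embeds_trans (seg_seg_embeds a) _).
  by apply: NNPP => /lx h; exact: (wo_le_not_lt woL h (proj2_sig a)).
- split; last by move=> /(ord_le_embeds wx woM).
  have [//|[m /(ord_le_embeds wx (seg_wo woM m)) h]] := wo_trichotomy woM wx.
  by case: nx; exact: (embeds_trans h (embeds_sub _)).
have inc : strict_incr ltL ltL (fun y => proj1_sig (f y)) by move=> y z /Hf.
exact: (wo_le_not_lt woL (strict_incr_ge woL inc x) (proj2_sig (f x))).
Qed.

Lemma succ_seg_small x : small M (fun y => ltL y x).
Proof.
by apply: embeds_small (succ_seg_embeds x); case: infM => s _; constructor; exact: (s 0).
Qed.

Lemma succ_not_embeds : ~ embeds L M.
Proof.
move=> h; have [card [[_ nle] _]] := succ.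
have [//|[x /(ord_le_embeds woM (seg_wo woL x)) Mx]] := wo_trichotomy woL woM.
exact: (card x (embeds_trans h Mx)).
Qed.

Lemma embeds_succ : embeds M L.
Proof. by have [_ [[h _] _]] := succ; exact: (ord_le_embeds woM woL h). Qed.

Lemma embeds_succ_square : embeds (L * L) L.
Proof. exact: (embeds_square woL (embeds_trans infM embeds_succ)). Qed.

(** If [g] were unbounded, [x] could be coded by some [a] with [x] below [g a] together with the
    place of [x] in an injection of that segment into [M], embedding [L] into the square of [M]. *)
Lemma succ_bounded (A : Type) (g : A -> L) : embeds A M -> bounded ltL g.
Proof.
move=> AM; apply: NNPP => nb; apply: succ_not_embeds.
have [card _] := succ.
have /choice_fun [a Ha] : forall x, exists a, ltL x (g a).
  move=> x; have [x' xx'] := infinite_cardinal_no_max woL (embeds_trans infM embeds_succ) card x.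
  apply: NNPP => n; apply: nb; exists x' => a; apply: (wo_le_lt woL _ xx').
  by apply: (wo_not_lt woL) => h; apply: n; exists a.
apply: embeds_trans (embeds_square woM infM).
apply: embeds_trans (embeds_prod AM (ex_intro _ id (fun _ _ e => e))).
have [e He] : exists e : L -> L -> M, forall x u v, ltL u x -> ltL v x -> e x u = e x v -> u = v.
  exact: choice_fun succ_seg_small.
exists (fun x => (a x, e (g (a x)) x)) => x y [E]; rewrite -E; apply: He => //.
by rewrite E.
Qed.

Lemma succ_regular : regular ltL.
Proof.
split=> //; split=> [x g|g]; apply: succ_bounded => //.
exact: succ_seg_embeds.
Qed.

End SuccessorCardinal.

Lemma small_subset {U : Type} (L : Type) (P Q : U -> Prop) :
  (forall u, P u -> Q u) -> small L Q -> small L P.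
Proof. by move=> h [e inj]; exists e => u v /h Qu /h Qv; exact: inj. Qed.

Lemma small_union {U A L : Type} (X : A -> U -> Prop) : inhabited A -> embeds A L -> embeds (L * L) L ->
  (forall a, small L (X a)) -> small L (fun u => exists a, X a u).
Proof.
move=> [a0] [f finj] [g ginj] sm.
have [e inj] : exists e : A -> U -> L, forall a u v, X a u -> X a v -> e a u = e a v -> u = v.
  exact: choice_fun sm.
pose a u := choose a0 (fun a => X a u).
have aP u : (exists a, X a u) -> X (a u) u by exact: chooseP.
exists (fun u => g (f (a u), e (a u) u)) => u v /aP hu /aP hv /ginj [/finj E].
by rewrite -E in hv *; exact: inj.
Qed.

(** Take a maximal family. If [e] numbered it by [L], one could diagonalize: at [z] fewer than [L]
    many members have number below [z], so some value [g z] avoids them all. By maximality [g] joins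
    the family and eventually differs from itself. *)
Lemma ex_eventually_different {L : Type} (lt : L -> L -> Prop) : regular lt -> is_cardinal lt ->
  exists A : (L -> L) -> Prop, ~ small L A /\
    forall f g, A f -> A g -> f <> g -> exists b, forall z, lt b z -> f z <> g z.
Proof.
move=> reg card; have wo := regular_wo reg.
pose R (f g : L -> L) := exists b, forall z, lt b z -> f z <> g z.
have [|A [_ [AR max]]] := @ex_maximal_clique (L -> L) (fun _ => True) R.
  by move=> f g [b hb]; exists b => z /hb n e; apply: n.
exists A; split=> // -[e inj].
have /choice_fun [g Hg] : forall z, exists u, forall f, A f -> lt (e f) z -> f z <> u.
  move=> z; apply: NNPP => n; apply: (card z).
  apply: (embeds_rel (R := fun u (y : seg lt z) => exists f, A f /\ proj1_sig y = e f /\ f z = u)).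
    move=> u; apply: NNPP => h; apply: n; exists u => f Af fz fu; apply: h.
    by exists (exist _ (e f) fz), f.
  move=> u u' y [f [Af [-> fu]]] [f' [Af' [E fu']]].
  by move: fu fu'; rewrite (inj _ _ Af Af' E) => -> ->.
have Ag : A g by apply: max => // f Af _; exists (e f) => z; exact: Hg.
by have [z hz] := regular_no_max reg (e g); case: (Hg z g Ag hz).
Qed.

Definition saturated {L : Type} (lt : L -> L -> Prop) (S : L -> Prop) : Prop :=
  forall Z : (L -> Prop) -> Prop,
    (forall X, Z X -> (forall x, X x -> S x) /\ stationary lt X) ->
    (forall X Y, Z X -> Z Y -> X <> Y -> ~ stationary lt (fun x => X x /\ Y x)) ->
    embeds {X | Z X} L.

(** Predensity in the algebra of subsets modulo non-stationary sets: the [D x] for [x] in [X] are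
    predense below each [D v] with [v] in [Y]. *)
Definition predense {L V : Type} (lt : L -> L -> Prop) (D : V -> L -> Prop) (X Y : V -> Prop) : Prop :=
  forall v Z, Y v -> stationary lt Z -> (forall x, Z x -> D v x) ->
    exists x, X x /\ stationary lt (fun y => Z y /\ D x y).

(** Take a maximal antichain of stationary sets each contained in some [D v] with [v] in [Y].
    Saturation bounds its size; choosing one [v] for each member gives [X], and maximality gives
    predensity. *)
Lemma ex_small_predense {L V : Type} (lt : L -> L -> Prop) (S : L -> Prop) (D : V -> L -> Prop)
    (Y : V -> Prop) : inhabited L -> saturated lt S -> (forall v y, D v y -> S y) ->
  exists X, small L X /\ (forall x, X x -> Y x) /\ predense lt D X Y.
Proof.
move=> iL sat DS.
pose P (Z : L -> Prop) := stationary lt Z /\ exists v, Y v /\ forall y, Z y -> D v y.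
have [X1 X2 n h|A [AP [AR max]]] :=
    @ex_maximal_clique _ P (fun X Y => ~ stationary lt (fun x => X x /\ Y x)).
  by apply: n; apply: stationary_subset h => x [].
have Asmall : embeds {Z | A Z} L.
  apply: sat => // Z /AP [st [v [_ h]]]; split=> // x Zx; exact: (DS v _ (h x Zx)).
have /choice_fun [v Hv] : forall Z : {Z | A Z}, exists v, Y v /\ forall y, proj1_sig Z y -> D v y.
  by case=> Z AZ; case: (AP Z AZ).
exists (fun x => exists Z, v Z = x); split; [|split].
- apply: embeds_small => //; apply: embeds_trans Asmall.
  apply: (embeds_rel (R := fun x Z => v Z = proj1_sig x)); first by case=> x [Z h]; exists Z.
  by move=> x x' Z h h'; apply: sub_val_inj; rewrite -h.
- by move=> x [Z <-]; case: (Hv Z).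
- move=> w Z Yw st ZD; apply: NNPP => n.
  have hZ X : A X -> ~ stationary lt (fun x => X x /\ Z x).
    move=> AX h; apply: n; exists (v (exist _ X AX)); split; first by eexists.
    apply: stationary_subset h => x [Xx Zx]; split=> //.
    exact: (proj2 (Hv (exist _ X AX)) x Xx).
  have AZ : A Z by apply: max => [|X /hZ]; first by split=> //; exists w.
  by apply: (hZ Z AZ); apply: stationary_subset st.
Qed.

(** * The contradiction from saturation *)

Section Main.
Variables (M : Type) (ltM : M -> M -> Prop) (K : Type) (ltK : K -> K -> Prop)
  (L : Type) (ltL : L -> L -> Prop).
Hypotheses (woM : is_wo ltM) (woK : is_wo ltK) (woL : is_wo ltL) (cardM : is_cardinal ltM)
  (cfMK : cf_eq ltM ltK) (ltKM : ord_lt ltK ltM) (omegaK : ord_lt Peano.lt ltK)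
  (succ : is_succ_cardinal ltM ltL).

Lemma infinite_cofinality : embeds nat K.
Proof. by case: omegaK => [h _]; exact: (ord_le_embeds nat_wo woK h). Qed.

Lemma embeds_cofinality : embeds K M.
Proof. by case: ltKM => [h _]; exact: (ord_le_embeds woK woM h). Qed.

Lemma cofinality_regular : regular ltK.
Proof. exact: (regular_cofinality woM woK cfMK omegaK). Qed.

(** Both factors fit into one infinite proper segment of the cardinal [M], and that segment absorbs
    products. *)
Lemma not_embeds_small_product m : ~ embeds M (K * (seg ltM m * seg ltM m)).
Proof.
have [x Kx] : exists x, embeds K (seg ltM x).
  have [/(proj2 ltKM)//|[x h]] := wo_trichotomy woM woK.
  by exists x; exact: (ord_le_embeds woK (seg_wo woM x) h).
have [y [xy [my _]]] := wo_le_max woM x m.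
have Ky := embeds_trans Kx (seg_embeds woM xy).
have sq := embeds_square (seg_wo woM y) (embeds_trans infinite_cofinality Ky).
have my' := seg_embeds woM my.
move=> h; apply: (cardM (a := y)); apply: embeds_trans h (embeds_trans _ sq).
exact: (embeds_prod Ky (embeds_trans (embeds_prod my' my') sq)).
Qed.

(** Inject each segment of [L] into [M] and cut [M] along a cofinal sequence [f] of type [K]; the
    resulting size bound does not depend on [y]. *)
Lemma ex_small_filtration : exists B, filtration ltL ltK B /\
  exists P : K -> Type, (forall i, ~ embeds M (K * (P i * P i))) /\
    forall y i, embeds {w | B y i w} (P i).
Proof.
have infM := embeds_trans infinite_cofinality embeds_cofinality.
have [e He] : exists e : L -> L -> M, forall x u v, ltL u x -> ltL v x -> e x u = e x v -> u = v.
  exact: (choice_fun (succ_seg_small woM woL infM succ)).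
have [[f [inc cof]] _] := cfMK.
exists (fun y i w => ltL w y /\ ltM (e y w) (f i)); split; [split; [|split]|].
- by move=> y i w [].
- by move=> y i j w [/inc h [? h']|->//]; split=> //; exact: (wo_trans woM h' h).
- move=> y w wy; have [_ [[i <-] h]] := cof (e y w).
  have [j ij] := regular_no_max cofinality_regular i.
  by exists j; split=> //; exact: (wo_le_lt woM h (inc _ _ ij)).
exists (fun i => seg ltM (f i)); split=> [i|y i]; first exact: not_embeds_small_product.
exists (fun w => exist (fun m => ltM m (f i)) (e y (proj1_sig w)) (proj2 (proj2_sig w))).
move=> [u [hu1 hu2]] [v [hv1 hv2]] [E]; apply: sub_val_inj => /=.
exact: He E.
Qed.

Lemma not_saturated theta : weakly_reflective (@seg_lt L ltL theta) ltK ->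
  ~ saturated ltL (S_cf ltL ltK).
Proof.
move=> refl sat.
have regK := cofinality_regular.
have infM := embeds_trans infinite_cofinality embeds_cofinality.
have regL := succ_regular woM woL infM succ.
have bdM := fun A g => @succ_bounded M L ltM ltL woM woL infM succ A g.
have ML := embeds_succ woM woL succ.
have sqL := embeds_succ_square woM woL infM succ.
have KL := embeds_trans embeds_cofinality ML.
have iK : inhabited K by case: infinite_cofinality => s _; constructor; exact: (s 0).
have iM : inhabited M by case: infM => s _; constructor; exact: (s 0).
have iL : inhabited L by constructor.
have [B [Bfil [P [Plarge BP]]]] := ex_small_filtration.
have [c cP] : exists c : L -> K -> L, forall d, S_cf ltL ltK d -> normal_seq ltL ltK d (c d).
  apply: (choice_fun (R := fun d cd => S_cf ltL ltK d -> normal_seq ltL ltK d cd)) => d.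
  case: (classic (S_cf ltL ltK d)) => [Sd|]; last by exists (fun _ => d).
  have [c0 hc0] := proj1 (S_cf_cofinal_seq woL regK d) Sd.
  by have [cd hcd] := ex_normal_seq woL regK hc0; exists cd.
pose D i f := guessed ltL ltK B c f i.
have [A [Abig Adiff]] := ex_eventually_different regL (proj1 succ).
pose Ai i f := A f /\ stationary ltL (D i f).
have [i Aibig] : exists i, ~ small L (Ai i).
  apply: NNPP => n; apply: Abig.
  have : small L (fun f => exists i, Ai i f).
    by apply: small_union => // i; apply: NNPP => h; apply: n; exists i.
  apply: small_subset => f Af.
  (* The points where [f] is guessed with some index form a stationary set, which splits into only
     [K] many pieces. *)
  have [j hj] : exists j, stationary ltL (D j f).
    apply: (stationary_cover regL); first by move=> g; exact: (bdM _ _ embeds_cofinality).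
    apply/(stationary_closure_pt regL) => b.
    have [d [cd [j hj]]] := guess_at_closure_pt regL regK Bfil cP f b iK refl.
    by exists d; split=> //; exists j.
  by exists j.
(* The relation [R] is the history of a recursion along [M]; discarding all functions used at
   earlier stages makes the families [X e] disjoint. *)
pose rest (R : M -> ((L -> L) -> Prop) -> Prop) f := Ai i f /\ forall e X, R e X -> ~ X f.
have [X HX] := @wf_rec M ((L -> L) -> Prop) ltM
  (fun _ R X => small L X /\ (forall f, X f -> rest R f) /\ predense ltL (D i) X (rest R))
  (wo_wf woM)
  (fun _ R => ex_small_predense (D := D i) (rest R) iL sat (fun f y h => proj1 h)).
have Xdisj e e' f : X e f -> X e' f -> e = e'.
  have lt_disj e1 e2 : ltM e1 e2 -> X e1 f -> X e2 f -> False.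
    by move=> h h1; case: (HX e2) => _ [H _] /H [_]; move/(_ e1 (X e1)); apply.
  by move=> h h'; case: (wo_total woM e e') => [/lt_disj/(_ h h')|[//|/lt_disj/(_ h' h)]].
have XA e f : X e f -> A f by case: (HX e) => _ [H _] /H [[]].
have [g ginj] : small L (fun f => exists e, X e f).
  by apply: small_union => // e; case: (HX e).
have [f [Af nXf]] : exists f, Ai i f /\ forall e, ~ X e f.
  apply: NNPP => n; apply: Aibig; exists g => u v Au Av; apply: ginj; apply: NNPP => h; apply: n.
    by exists u; split=> // e Xe; apply: h; exists e.
  by exists v; split=> // e Xe; apply: h; exists e.
(* Almost every point of [D i f] lies in some [D i x], with [x] in [X e] of index below it. *)
have /choice_fun [b Hb] : forall e, exists b, forall y, closure_pt ltL b y ->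
    ~ (D i f y /\ ~ exists x, X e x /\ ltL (g x) y /\ D i x y).
  move=> e; apply: (nonstationary_closure_pt regL) => st.
  have [_ [_ pre]] := HX e.
  (* Closure points of the constant function are exactly the nonzero points above [g x]; this gives
     the requirement that the number of [x] be below [y]. *)
  have [||x [Xx /(stationary_closure_pt regL)/(_ (fun _ => g x))]] := pre f _ _ st.
  - by split=> // e' Y [_ <-].
  - by move=> y [].
  by move=> [y [[[_ n] Dx] [[z zy] h]]]; apply: n; exists x; do !split=> //; exact: h zy.
(* Beyond [s k] the function numbered [k] differs from all those of smaller number; fewer than [L]
   many bounds are combined by regularity. *)
have /choice_fun [s Hs] : forall k, exists l, forall x y, (exists e, X e x) -> (exists e, X e y) ->
    g x = k -> ltL (g y) k -> forall z, ltL l z -> x z <> y z.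
  move=> k; case: (classic (exists x, (exists e, X e x) /\ g x = k)) => [[x [Ux gx]]|n]; last first.
    by exists k => x y Ux _ gx; case: n; exists x.
  have /choice_fun [t Ht] : forall j : seg ltL k, exists l, forall y, (exists e, X e y) ->
      g y = proj1_sig j -> forall z, ltL l z -> x z <> y z.
    case=> j jk; case: (classic (exists y, (exists e, X e y) /\ g y = j)) => [[y [Uy gy]]|n].
      have [l hl] : exists l, forall z, ltL l z -> x z <> y z.
        case: Ux Uy => e1 /XA Ax [e2 /XA Ay]; apply: Adiff => // E.
        by move: jk; rewrite -gy -gx E => /(wo_irr woL).
      by exists l => y' Uy' /= gy'; rewrite (ginj y' y) // gy'.
    by exists j => y Uy gy; case: n; exists y.
  case: regL => _ [/(_ k t) [l hl] _]; exists l => x' y Ux' Uy gx' gy z lz.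
  rewrite (ginj x' x) //; last by rewrite gx'.
  by apply: (Ht (exist _ (g y) gy)) => //; exact: (wo_trans woL (hl _) lz).
have [b1 Hb1] := common_closure_pt regL b (fun h => bdM _ h (ex_intro _ id (fun _ _ e => e))).
have /choice_fun [b2 Hb2] : forall x, exists z, ltL (b1 x) z /\ ltL (s x) z.
  by move=> x; exact: regular_above2.
have [d [Dd cd]] := proj1 (stationary_closure_pt regL _) (proj2 Af) b2.
have cb1 : closure_pt ltL b1 d by apply: closure_pt_mono cd => // x; left; case: (Hb2 x).
have [_ cs] : closure_pt ltL s d by apply: closure_pt_mono cd => // x; left; case: (Hb2 x).
(* As [d] is closed under [s], the guess can be taken at some [w] past [s (g x)], where distinct
   functions are already separated. *)
have wit e : exists x k w, X e x /\ ltL (g x) d /\ ltL (s (g x)) w /\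
    B (c d k) i w /\ B (c d k) i (x w).
  have [x [Xx [gx [_ Dx]]]] : exists x, X e x /\ ltL (g x) d /\ D i x d.
    by apply: NNPP => n; apply: (Hb e d (Hb1 e d cb1)).
  by have [k [w [sw [B1 B2]]]] := Dx _ (cs _ gx); exists x, k, w.
have iP : inhabited (P i).
  case: iM => e0; have [x [k [w [_ [_ [_ [B1 _]]]]]]] := wit e0.
  by case: (BP (c d k) i) => u _; constructor; exact: (u (exist _ w B1)).
have [u uinj] : exists u : L -> L -> P i, forall y w w', B y i w -> B y i w' -> u y w = u y w' -> w = w'.
  exact: (choice_fun (fun y => embeds_small iP (BP y i))).
apply: (Plarge i).
(* Code [e] by [k] and the positions of [w] and [x w] in the small set [B (c d k) i]. *)
apply: (embeds_rel (R := fun e p => exists x w, X e x /\ ltL (g x) d /\ ltL (s (g x)) w /\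
  B (c d (fst p)) i w /\ B (c d (fst p)) i (x w) /\
  snd p = (u (c d (fst p)) w, u (c d (fst p)) (x w)))).
  move=> e; have [x [k [w h]]] := wit e.
  by exists (k, (u (c d k) w, u (c d k) (x w))), x, w; intuition.
move=> e e' [k p] /= [x [w [Xx [gx [sw [B1 [B2 ->]]]]]]] [x' [w' [Xx' [gx' [sw' [B1' [B2' [E1 E2]]]]]]]].
have E := uinj _ _ _ B1 B1' E1; subst w'.
have Ew := uinj _ _ _ B2 B2' E2.
(* Equal codes make [x] and [x'] agree at [w]. Unequal numbers contradict the choice of [s] at the
   larger one; equal numbers give [x = x'], and disjointness gives [e = e']. *)
case: (wo_total woL (g x) (g x')) => [h|[h|h]].
- by case: (Hs _ x' x _ _ eq_refl h w sw'); [exists e'|exists e|].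
- by apply: (Xdisj _ _ x) => //; rewrite (ginj x x') //; [exists e|exists e'].
- by case: (Hs _ x x' _ _ eq_refl h w sw); [exists e|exists e'|].
Qed.

End Main.

Theorem theorem1p13
  (M : Type) (ltM : M -> M -> Prop) (K : Type) (ltK : K -> K -> Prop)
  (L : Type) (ltL : L -> L -> Prop) :
  is_wo ltM -> is_wo ltK -> is_wo ltL ->
  is_cardinal ltM ->
  cf_eq ltM ltK ->                       (* cf(mu) = kappa *)
  ord_lt ltK ltM ->                      (* kappa < mu *)
  ord_lt Peano.lt ltK ->                 (* aleph_0 < kappa *)
  is_succ_cardinal ltM ltL ->            (* lambda = mu^+ *)
  (exists theta : L, ord_lt ltK (@seg_lt L ltL theta) /\
                     weakly_reflective (@seg_lt L ltL theta) ltK) ->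
  exists (I : Type) (F : I -> L -> Prop),
    (~ exists g : I -> L, injective_fun g) /\          (* at least lambda^+ many *)
    (forall i, (forall x, F i x -> S_cf ltL ltK x) /\ stationary ltL (F i)) /\
    (forall i j, i <> j -> ~ stationary ltL (fun x => F i x /\ F j x)).
Proof.
move=> woM woK woL cardM cfMK ltKM omegaK succ [theta [_ refl]]; apply: NNPP => n.
apply: (not_saturated woM woK woL cardM cfMK ltKM omegaK succ refl) => Z ZS Zdisj.
apply: NNPP => big; apply: n; exists {X | Z X}, (fun X => proj1_sig X); split; [|split].
- by move=> [g ginj]; apply: big; exists g.
- by move=> X; exact: (ZS _ (proj2_sig X)).
- move=> X Y XY; apply: Zdisj; [exact: (proj2_sig X)|exact: (proj2_sig Y)|].
  by move=> /sub_val_inj.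
Qed.
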